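(* Let $C=6\sqrt{8}\times 10^6$. Then for all integers $n\ge 1$ and $N\ge 1$ with $N>\sqrt{C}\,n^{3/2}$, and for all $\sigma\in S_n$, $$\frac{N^{n+|\sigma|}\,\mathrm{Wg}_N^{\mathrm U}(\sigma)}{\mathrm{Moeb}(\sigma)}\le \frac{1}{1-\frac{Cn^3}{N^2}}.$$
   Context: $S_n$ is the group of permutations of $[n]=\{1,\dots,n\}$, and $S_0:=\{\varnothing\}$. For $\sigma\in S_n$ with $l$ cycles (fixed points count as cycles of length 1), $|\sigma|:=n-l$. $\mathrm{Cat}(k)=\frac{(2k)!}{k!(k+1)!}$. If the cycles of $\sigma$ have lengths $C_1,\dots,C_l$, then $\mathrm{Moeb}(\sigma):=(-1)^{|\sigma|}\prod_{i=1}^l \mathrm{Cat}(C_i-1)$. Unitary Weingarten graph: the directed graph with vertex set $\bigsqcup_{n\ge 0}S_n$ and two kinds of edges. For $\sigma,\sigma'\in S_n$ there is a solid edge $\sigma\to\sigma'$ if $\sigma'=(i\; n)\sigma$ for some $1\le i\le n-1$. If $\sigma\in S_n$ ($n\ge1$) fixes $n$, there is a dashed edge $\sigma\to\sigma|_{[n-1]}\in S_{n-1}$. $\mathrm P(\sigma,l)$ is the set of directed paths from $\sigma$ to $\varnothing$ using exactly $l$ solid edges. Unitary Weingarten function: for $n\le N$ and $\sigma\in S_n$, $$\mathrm{Wg}^{\mathrm U}_N(\sigma)=(-1)^{|\sigma|}N^{-n-|\sigma|}\sum_{g=0}^\infty |\mathrm P(\sigma,|\sigma|+2g)|\,N^{-2g}$$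 (a convergent series). *)

(* Defs.v *)
From mathcomp Require Import all_boot all_order all_algebra all_fingroup finmap.
From mathcomp Require Import all_classical all_reals all_analysis.

Set Implicit Arguments.
Unset Strict Implicit.
Unset Printing Implicit Defensive.

Import Order.TTheory GRing.Theory Num.Theory.
Import numFieldNormedType.Exports.

Local Open Scope ring_scope.

(* The set [n] = {1, ..., n} is encoded as 'I_n = {0, ..., n-1}; the label n
   of [n] is the last element of 'I_n, written ord_max. *)

Definition perm_norm (n : nat) (s : 'S_n) : nat := (n - #|porbits s|)%N.

Definition Cat (R : realType) (k : nat) : R :=
  ((2 * k)`!)%:R / ((k`!)%:R * (k.+1`!)%:R).

Definition Moeb (R : realType) (n : nat) (s : 'S_n) : R :=
  (-1) ^+ perm_norm s * \prod_(c in porbits s) Cat R #|c|.-1.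

Definition wg_vertex : Type := {n : nat & 'S_n}.

Definition to_vertex (n : nat) (s : 'S_n) : wg_vertex := existT _ n s.

Definition wg_empty : wg_vertex := to_vertex (1%g : 'S_0).

(* The product of permutations in MathComp applies its left factor first, so
   (i n) o s is written s * tperm i ord_max. *)
Definition solid_edge (u v : wg_vertex) : bool :=
  match u with existT n s =>
    match n return 'S_n -> bool with
    | 0 => fun=> false
    | m.+1 => fun s : 'S_m.+1 =>
        [exists i : 'I_m.+1,
          (i != ord_max) && (v == to_vertex (s * tperm i ord_max)%g)]
    end s
  end.

Definition dashed_edge (u v : wg_vertex) : bool :=
  match u with existT n s =>
    match n return 'S_n -> bool with
    | 0 => fun=> false
    | m.+1 => fun s : 'S_m.+1 =>
        (s ord_max == ord_max) &&
        [exists t : 'S_m,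
          (v == to_vertex t) &&
          [forall i : 'I_m,
            s (widen_ord (leqnSn m) i) == widen_ord (leqnSn m) (t i)]]
    end s
  end.

Definition wg_edge (u v : wg_vertex) : bool := solid_edge u v || dashed_edge u v.

Definition nb_solid (u : wg_vertex) (p : seq wg_vertex) : nat :=
  count (fun e => solid_edge e.1 e.2) (zip (u :: p) p).

(* The Weingarten graph has no multiple edges (two vertices are joined by at
   most one edge, of one kind), so a path is the sequence of its vertices; as
   for [path], the initial vertex is left out of the sequence. *)
Definition wg_paths (n : nat) (s : 'S_n) (l : nat) : set (seq wg_vertex) :=
  [set p | [/\ path wg_edge (to_vertex s) p,
               last (to_vertex s) p = wg_empty
             & nb_solid (to_vertex s) p = l]]%classic.

(* [fset_set] sends an infinite set to the empty one, but wg_paths s l is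
   finite: its elements have n dashed and l solid edges, and each vertex has
   finitely many successors. *)
Definition nb_paths (n : nat) (s : 'S_n) (l : nat) : nat :=
  #|` fset_set (wg_paths s l)|%fset.

(* Meaningful for n <= N, in which case the series converges. *)
Definition WgU (R : realType) (N n : nat) (s : 'S_n) : R :=
  (-1) ^+ perm_norm s * N%:R ^- (n + perm_norm s) *
  limn (series
    (fun g => (nb_paths s (perm_norm s + 2 * g))%:R * N%:R ^- (2 * g) : R)).

(* Main.v *)
Require Import Defs.
From mathcomp Require Import all_boot all_order all_algebra all_fingroup finmap.
From mathcomp Require Import all_classical all_reals all_analysis.
From mathcomp Require Import ring lra zify.
Import Order.TTheory GRing.Theory Num.Theory.
Import numFieldNormedType.Exports.
Local Open Scope ring_scope.

Set Implicit Arguments.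
Unset Strict Implicit.

(* Let a_g(s) be the number of paths from s with |s| + 2g solid edges. Looking at
   the first edge of a path,
     a_g(s) = [n is fixed] a_g(s restricted to [n-1])
            + sum of a_g over the ways of cutting the cycle of n in two
            + sum of a_(g-1) over the ways of merging it with another cycle.
   With lambda the cycle type of s, put a0 = prod_i Cat(lambda_i - 1), and
     h(p, q) = 2pq(2p-1)(2q-1) / (p+q),  V = (1/2) sum_(i, j) h(lambda_i, lambda_j).
   Off the diagonal, h(p, q) Cat(p-1) Cat(q-1) is the genus 0 annular count, and
   a0 * V is a supersolution of the recursion for g = 1 with source term a0.
   As V <= 2n^3 <= K := C n^3, the functions a0 and a0 * V * K^(g-1) are
   supersolutions for g = 0 and g >= 1, so that a_g <= a0 * K^g, and the
   Weingarten series is dominated by a geometric one. *)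

(** * Catalan convolutions and the pair weight *)

Section Catalan.
Variable R : realType.
Implicit Types (p q k : nat).

Lemma Cat_gt0 k : 0 < Cat R k.
Proof. by rewrite /Cat divr_gt0 ?mulr_gt0 ?ltr0n ?fact_gt0. Qed.

Lemma Cat0 : Cat R 0 = 1.
Proof. by rewrite /Cat muln0 fact0 mulr1 divr1. Qed.

Lemma CatS k : Cat R k.+1 = 2 * (2 * k%:R + 1) / (k%:R + 2) * Cat R k.
Proof.
rewrite /Cat.
have -> : (2 * k.+1 = (2 * k).+2)%N by lia.
rewrite (factS (2 * k).+1) (factS (2 * k)) (factS k.+1) (factS k).
rewrite !natrM -!natr1 !natrM.
have hf : (k`!)%:R != 0 :> R by rewrite pnatr_eq0 -lt0n fact_gt0.
have hk : 0 <= k%:R :> R by apply: ler0n.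
field.
rewrite hf /=; apply/andP; split; lra.
Qed.

(** The central binomial coefficient $\binom{2k}{k}$. *)
Definition cbin k : R := k.+1%:R * Cat R k.

Lemma cbin0 : cbin 0 = 1. Proof. by rewrite /cbin Cat0 mulr1. Qed.

Lemma cbinS k : cbin k.+1 = 2 * (2 * k%:R + 1) / (k%:R + 1) * cbin k.
Proof.
rewrite /cbin CatS -!natr1.
have hk : 0 <= k%:R :> R by apply: ler0n.
by field; apply/andP; split; lra.
Qed.

Lemma cbinS_Cat k : cbin k.+1 = 2 * (2 * k%:R + 1) * Cat R k.
Proof.
rewrite cbinS /cbin -natr1.
have hk : 0 <= k%:R :> R by apply: ler0n.
by field; lra.
Qed.

(** For p, q > 0, this is 1/q times the number of noncrossing annular permutations with p and q
    points on the two circles. *)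
Definition annul p q : R := p%:R * cbin p * cbin q / (2 * (p%:R + q%:R)).

Lemma annul0 q : annul 0 q = 0.
Proof. by rewrite /annul !mul0r. Qed.

Lemma annulS p q : annul p.+1 q = cbin p * Cat R q + annul p q.+1.
Proof.
rewrite /annul !cbinS /cbin -!natr1.
have hp : 0 <= p%:R :> R by apply: ler0n.
have hq : 0 <= q%:R :> R by apply: ler0n.
by field; do ?[apply/andP; split]; lra.
Qed.

(** [annulS] telescopes: each use moves one unit from the first argument to the second and leaves
    one summand. *)
Lemma sum_cbin_Cat p q :
  \sum_(j < p) cbin (p.-1 - j) * Cat R (q + j) = annul p q.
Proof.
elim: p q => [|p IH] q; first by rewrite big_ord0 annul0.
rewrite big_ord_recl /= subn0 addn0 annulS -IH; congr (_ + _).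
apply: eq_bigr => j _; rewrite /bump /= add1n addnS addSn; congr (cbin _ * _).
by case: j => j /= ?; lia.
Qed.

Lemma conv_cbin_Cat p :
  \sum_(j < p.+1) cbin (p - j) * Cat R j = cbin p.+1 / 2.
Proof.
have := sum_cbin_Cat p.+1 0.
under eq_bigr do rewrite add0n.
move=> -> ; rewrite /annul cbin0 -natr1.
have hp : 0 <= p%:R :> R by apply: ler0n.
by field; lra.
Qed.

(* Averaging the convolution of [cbin] and [Cat] with its mirror image turns
   the factor [p - j + 1] of [cbin] into the constant [(p + 2) / 2]. *)
Lemma Cat_rec p : Cat R p.+1 = \sum_(j < p.+1) Cat R j * Cat R (p - j).
Proof.
have hp : 0 <= p%:R :> R by apply: ler0n.
have e1 := conv_cbin_Cat p.
have e2 : \sum_(j < p.+1) cbin j * Cat R (p - j) = cbin p.+1 / 2.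
  rewrite -e1 (reindex_inj rev_ord_inj) /=; apply: eq_bigr => j _.
  rewrite subSS; congr (_ * Cat R _).
  by case: j => j /= ?; lia.
have : \sum_(j < p.+1) (p%:R + 2) * (Cat R j * Cat R (p - j)) = cbin p.+1.
  transitivity (cbin p.+1 / 2 + cbin p.+1 / 2); last by field.
  rewrite -{1}e1 -e2 -big_split /=; apply: eq_bigr => j _.
  have hj : (j <= p)%N by case: j => j /= ?; lia.
  by rewrite /cbin -!natr1 natrB //; ring.
have h : p%:R + 2 != 0 :> R by lra.
rewrite -mulr_sumr /cbin -[p.+2%:R]natr1 -[p.+1%:R]natr1 => e.
by apply: (mulfI h); apply: (etrans _ (esym e)); ring.
Qed.

(** The planar recursion for cycles of lengths p + 1 and q. After a cut of the first cycle, the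
    second stays attached to either piece, hence the factor 2; a merge gives one cycle of length p +
    q + 1. *)
Lemma annul_rec p q :
  annul p.+1 q = 2 * (\sum_(k < p.+1) Cat R (p - k) * annul k q) + Cat R (p + q).
Proof.
elim: p q => [|p IH] q.
  by rewrite big_ord1 annul0 annulS cbin0 /annul !mul0r; ring.
rewrite annulS big_ord_recl annul0 mulr0 add0r.
under eq_bigr => k _ do rewrite lift0 subSS annulS mulrDr mulrA.
rewrite big_split /= -mulr_suml.
have -> : \sum_(i < p.+1) Cat R (p - i) * cbin i = cbin p.+1 / 2.
  rewrite -conv_cbin_Cat (reindex_inj rev_ord_inj) /=; apply: eq_bigr => j _.
  rewrite subSS mulrC; congr (_ * Cat R _).
  by case: j => j /= ?; lia.
by rewrite IH addnS addSn; field.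
Qed.

Definition pairw p q : R :=
  2 * p%:R * q%:R * (2 * p%:R - 1) * (2 * q%:R - 1) / (p%:R + q%:R).

Lemma pairwC p q : pairw p q = pairw q p.
Proof. by rewrite /pairw [q%:R + _]addrC; congr (_ / _); ring. Qed.

Lemma pairw_annul p q : (0 < q)%N ->
  Cat R p.-1 * pairw p q = q%:R * annul p q / Cat R q.-1.
Proof.
case: q p => // q [|p] _; first by rewrite annul0 /pairw !(mulr0, mul0r).
rewrite /pairw /annul !cbinS_Cat /=.
have hp : 0 <= p%:R :> R by apply: ler0n.
have hq : 0 <= q%:R :> R by apply: ler0n.
have hc := Cat_gt0 q.
rewrite -!natr1; field.
by rewrite gt_eqF // ; lra.
Qed.

(** This is [annul_rec] rewritten for h. The symmetry between k and p - 1 - k makes the two halves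
    of the sum equal, which accounts for the factor 2. *)
Lemma pairw_rec p q : (0 < q)%N ->
  Cat R p * pairw p.+1 q =
  \sum_(k < p) Cat R k * Cat R (p.-1 - k) * (pairw k.+1 q + pairw (p - k) q)
  + q%:R * Cat R (p + q) / Cat R q.-1.
Proof.
move=> q0.
have -> : \sum_(k < p) Cat R k * Cat R (p.-1 - k) *
    (pairw k.+1 q + pairw (p - k) q) =
  2 * \sum_(k < p) Cat R k * Cat R (p.-1 - k) * pairw k.+1 q.
  under eq_bigr do rewrite mulrDr.
  rewrite big_split /= mulr_natl mulr2n; congr (_ + _).
  rewrite (reindex_inj rev_ord_inj) /=; apply: eq_bigr => -[j /= hj] _.
  rewrite [Cat R (p - _) * _]mulrC.
  by congr (Cat R _ * Cat R _ * pairw _ _); lia.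
rewrite (pairw_annul p.+1) // annul_rec big_ord_recl annul0 mulr0 add0r.
under [X in 2 * X + _]eq_bigr => k _ do rewrite lift0.
have -> : \sum_(k < p) Cat R k * Cat R (p.-1 - k) * pairw k.+1 q =
  q%:R / Cat R q.-1 * \sum_(i < p) Cat R (p - i.+1) * annul i.+1 q.
  rewrite mulr_sumr; apply: eq_bigr => -[j /= hj] _.
  rewrite mulrAC (pairw_annul j.+1) //.
  have -> : (p.-1 - j = p - j.+1)%N by lia.
  by ring.
by ring.
Qed.

(** Controls the diagonal of V: when a cycle of length k + l is cut, the diagonal terms of the
    pieces and their mutual term are paid for by the diagonal term of the whole cycle. *)
Lemma pairw_split k l : (0 < k)%N -> (0 < l)%N ->
  (pairw k k + pairw l l) / 2 + pairw k l <= pairw (k + l) (k + l) / 2.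
Proof.
case: k l => // k [] // l _ _.
rewrite /pairw natrD -[k.+1%:R]natr1 -[l.+1%:R]natr1.
have : 0 <= k%:R :> R by apply: ler0n.
have : 0 <= l%:R :> R by apply: ler0n.
move: (k%:R) (l%:R) => x y hy hx.
rewrite -subr_ge0.
set e := (X in 0 <= X).
(* With s = x + y + 2, one has (2x+1)(2y+1) <= (s-1)^2, so the long factor is at least 4s^2 - 2 >
   0. *)
have -> : e = (x + 1) * (y + 1) * (6 * (x + y + 2) ^+ 2 - 4 * (x + y + 2)
   - 2 * (2 * x + 1) * (2 * y + 1)) / (x + y + 2).
  by rewrite /e; field; do ?[apply/andP; split]; lra.
apply: divr_ge0; last by lra.
apply: mulr_ge0; first by apply: mulr_ge0; lra.
by nra.
Qed.

Lemma pairw_le p q n : (p <= n)%N -> (q <= n)%N ->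
  pairw p q <= 4 * n%:R * p%:R * q%:R.
Proof.
rewrite -(ler_nat R) -(ler_nat R q).
case: p => [|p]; first by rewrite /pairw !(mulr0, mul0r).
case: q => [|q]; first by rewrite /pairw !(mulr0, mul0r).
rewrite /pairw -[p.+1%:R]natr1 -[q.+1%:R]natr1.
have : 0 <= p%:R :> R by apply: ler0n.
have : 0 <= q%:R :> R by apply: ler0n.
move: (p%:R) (q%:R) (n%:R) => x y z hy hx xz yz.
rewrite ler_pdivrMr; last by lra.
have -> : 4 * z * (x + 1) * (y + 1) * (x + 1 + (y + 1)) = 
  (2 * (x + 1) * (y + 1)) * (2 * z * (x + y + 2)) by ring.
have -> : 2 * (x + 1) * (y + 1) * (2 * (x + 1) - 1) * (2 * (y + 1) - 1) =
  (2 * (x + 1) * (y + 1)) * ((2 * x + 1) * (2 * y + 1)) by ring.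
apply: ler_pM => //; [nra|nra|].
(* The chain is (2p-1)(2q-1) <= (p+q)^2 <= 2n(p+q). *)
apply: (@le_trans _ _ ((x + y + 2) * (x + y + 2))).
  by have := sqr_ge0 (x - y); nra.
by apply: ler_wpM2r; lra.
Qed.

Lemma pairw_ge0 p q : 0 <= pairw p q.
Proof.
case: p => [|p]; first by rewrite /pairw !(mulr0, mul0r).
case: q => [|q]; first by rewrite /pairw !(mulr0, mul0r).
have hp : 0 <= p%:R :> R by apply: ler0n.
have hq : 0 <= q%:R :> R by apply: ler0n.
rewrite /pairw -!natr1 divr_ge0 ?mulr_ge0 //; lra.
Qed.

End Catalan.

(** * Supersolutions on lists of cycle lengths *)

Section CycleTypeWeights.
Variable R : realType.
Implicit Types (p q k g : nat) (L : seq nat).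

(** Cycle types are lists up to [perm_eq]. In the notation above, [catw] is a0, [pairsum] is V and
    [pairw] is h. *)
Definition catw L : R := \prod_(x <- L) Cat R x.-1.

Definition pairsum L : R := (\sum_(x <- L) \sum_(y <- L) pairw R x y) / 2.

Lemma catw_cons p L : catw (p :: L) = Cat R p.-1 * catw L.
Proof. by rewrite /catw big_cons. Qed.

Lemma catw_gt0 L : 0 < catw L.
Proof. by apply: prodr_gt0 => *; apply: Cat_gt0. Qed.

Lemma perm_catw L1 L2 : perm_eq L1 L2 -> catw L1 = catw L2.
Proof. exact: perm_big. Qed.

Lemma perm_pairsum L1 L2 : perm_eq L1 L2 -> pairsum L1 = pairsum L2.
Proof.
move=> e; rewrite /pairsum (perm_big _ e) /=; congr (_ / _).
by apply: eq_bigr => x _; rewrite (perm_big _ e).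
Qed.

Lemma pairsum_cons p L :
  pairsum (p :: L) = pairsum L + \sum_(q <- L) pairw R p q + pairw R p p / 2.
Proof.
rewrite /pairsum !big_cons.
under [X in _ + X]eq_bigr do rewrite big_cons pairwC.
rewrite big_split /=.
by field.
Qed.

Lemma pairsum_ge0 L : 0 <= pairsum L.
Proof.
by rewrite /pairsum divr_ge0 //; do 2![apply: sumr_ge0 => ? _]; apply: pairw_ge0.
Qed.

Lemma pairsum_le L n : (sumn L <= n)%N -> pairsum L <= 2 * n%:R ^+ 3.
Proof.
move=> hL.
have hx x : x \in L -> (x <= n)%N.
  by move=> xL; apply: leq_trans hL; rewrite sumnE (big_rem x) //= leq_addr.
rewrite /pairsum ler_pdivrMr //.
apply: (@le_trans _ _ (\sum_(x <- L) \sum_(y <- L) 4 * n%:R * x%:R * y%:R)).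
  rewrite big_seq [leRHS]big_seq; apply: ler_sum => x xL.
  rewrite big_seq [leRHS]big_seq; apply: ler_sum => y yL.
  by apply: pairw_le; apply: hx.
under eq_bigr do rewrite -mulr_sumr.
rewrite -mulr_suml -mulr_sumr -natr_sum -sumnE.
have -> : 2 * n%:R ^+ 3 * 2 = 4 * n%:R * n%:R * n%:R :> R by ring.
by rewrite -!natrM ler_nat; rewrite leq_mul // leq_mul.
Qed.

(** The recursion for g = 0, with equality. The cycle of n has length p + 1: it is erased if p = 0,
    and cut in p ways otherwise. *)
Lemma catw_rec p L :
  (p == 0)%:R * catw L + \sum_(k < p) catw [:: k.+1, (p - k)%N & L] =
  catw (p.+1 :: L).
Proof.
rewrite catw_cons /=; case: p => [|p]; first by rewrite big_ord0 Cat0 eqxx addr0.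
rewrite mul0r add0r Cat_rec mulr_suml; apply: eq_bigr => -[k /= hk] _.
by rewrite !catw_cons mulrA /=; congr (_ * Cat R _ * _); lia.
Qed.

(** V of the whole list has three parts. The part inside [L] follows the Catalan recursion; the
    interaction of the cycle of n with [L] follows [pairw_rec], whose last term is exactly the
    merging contribution; the diagonal term is handled by [pairw_split], and only there is equality
    lost. *)
Lemma pairsum_rec p L : all (leq 1) L ->
  (p == 0)%:R * (catw L * pairsum L)
  + \sum_(k < p) catw [:: k.+1, (p - k)%N & L] * pairsum [:: k.+1, (p - k)%N & L]
  + \sum_(q <- L) q%:R * (Cat R (p + q) * catw L / Cat R q.-1)
  <= catw (p.+1 :: L) * pairsum (p.+1 :: L).
Proof.
move=> Lpos; set S := fun x => \sum_(q <- L) pairw R x q.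
set w : nat -> R := fun k => Cat R k * Cat R (p.-1 - k).
(* The Catalan recursion in a form that includes p = 0, read off from [catw_rec] by cancelling
   [catw L]. *)
have eCat : Cat R p = (p == 0)%:R + \sum_(k < p) w k.
  have := catw_rec p L; rewrite catw_cons /= => e.
  have h := lt0r_neq0 (catw_gt0 L); apply: (mulIf h); rewrite -{}e mulrDl.
  congr (_ + _); rewrite mulr_suml; apply: eq_bigr => -[k /= hk] _.
  by rewrite !catw_cons mulrA /w; congr (_ * Cat R _ * _); lia.
have -> : \sum_(k < p) catw [:: k.+1, (p - k)%N & L] *
    pairsum [:: k.+1, (p - k)%N & L] =
  catw L * (\sum_(k < p) w k * pairsum L + \sum_(k < p) w k * (S k.+1 + S (p - k)%N)
    + \sum_(k < p) w k * ((pairw R k.+1 k.+1 + pairw R (p - k) (p - k)) / 2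
        + pairw R k.+1 (p - k))).
  rewrite -!big_split mulr_sumr; apply: eq_bigr => -[k /= hk] _.
  rewrite !catw_cons /= !pairsum_cons big_cons -/(S _) /w.
  have -> : (p - k).-1 = (p.-1 - k)%N by lia.
  by rewrite /S; field.
have -> : \sum_(q <- L) q%:R * (Cat R (p + q) * catw L / Cat R q.-1) =
  catw L * \sum_(q <- L) (q%:R * Cat R (p + q) / Cat R q.-1).
  by rewrite mulr_sumr; apply: eq_bigr => q _; ring.
have eS : Cat R p * S p.+1 = \sum_(k < p) w k * (S k.+1 + S (p - k)%N)
    + \sum_(q <- L) (q%:R * Cat R (p + q) / Cat R q.-1).
  have -> : \sum_(k < p) w k * (S k.+1 + S (p - k)%N) =
     \sum_(q <- L) \sum_(k < p) w k * (pairw R k.+1 q + pairw R (p - k) q).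
    rewrite exchange_big; apply: eq_bigr => k _.
    by rewrite -mulr_sumr big_split.
  rewrite -big_split mulr_sumr big_seq [RHS]big_seq; apply: eq_bigr => q qL /=.
  by rewrite pairw_rec //; move/allP: Lpos; apply.
have dle : \sum_(k < p) w k * ((pairw R k.+1 k.+1 + pairw R (p - k) (p - k)) / 2
        + pairw R k.+1 (p - k)) <= Cat R p * (pairw R p.+1 p.+1 / 2).
  rewrite eCat mulrDl mulr_suml ler_wpDl ?mulr_ge0 ?pairw_ge0 ?ler0n ?divr_ge0 //.
  apply: ler_sum => -[k /= hk] _.
  apply: ler_wpM2l; first by rewrite mulr_ge0 // ltW ?Cat_gt0.
  have -> : p.+1 = (k.+1 + (p - k))%N by lia.
  by rewrite pairw_split //; lia.
rewrite catw_cons pairsum_cons /= -/(S _).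
rewrite [leRHS](_ : _ = catw L *
  (Cat R p * pairsum L + Cat R p * S p.+1 + Cat R p * (pairw R p.+1 p.+1 / 2)));
  last by ring.
rewrite eS {1}eCat mulrDl mulr_suml mulrCA -!mulrDr ler_pM2l ?catw_gt0 //.
by move: dle; lra.
Qed.

(** The simpler candidate a0 * K^g already gives equality for erasing and cutting, which leaves no
    room for merging; the factor V creates that room. *)
Definition genus_bound (K : R) g L : R :=
  if g is g'.+1 then catw L * pairsum L * K ^+ g' else catw L.

Lemma perm_genus_bound (K : R) g L1 L2 :
  perm_eq L1 L2 -> genus_bound K g L1 = genus_bound K g L2.
Proof.
by case: g => [|g] e /=; rewrite (perm_catw e) ?(perm_pairsum e).
Qed.

Lemma genus_bound_le (K : R) g L : 0 <= K -> pairsum L <= K ->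
  genus_bound K g L <= catw L * K ^+ g.
Proof.
move=> K0 hL; case: g => [|g] /=; first by rewrite mulr1.
rewrite exprS (mulrA _ K); apply: ler_wpM2r; first exact: exprn_ge0.
by apply: ler_wpM2l => //; apply/ltW/catw_gt0.
Qed.

Lemma genus_bound_ge0 (K : R) g L : 0 <= K -> 0 <= genus_bound K g L.
Proof.
move=> K0; case: g => [|g] /=; first exact/ltW/catw_gt0.
apply: mulr_ge0; last exact: exprn_ge0.
by apply: mulr_ge0; [apply/ltW/catw_gt0 | apply: pairsum_ge0].
Qed.

(** The merging term carries a0 * K^(g-1), the weakened bound of genus g - 1, so that [pairsum_rec]
    only has to be multiplied by a power of K. *)
Lemma genus_bound_rec (K : R) g p L : 0 <= K -> all (leq 1) L ->
  (p == 0)%:R * genus_bound K g L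
  + \sum_(k < p) genus_bound K g [:: k.+1, (p - k)%N & L]
  + (if g is g'.+1 then
       \sum_(q <- L) q%:R * (Cat R (p + q) * catw L / Cat R q.-1 * K ^+ g') else 0)
  <= genus_bound K g (p.+1 :: L).
Proof.
move=> K0 Lpos; case: g => [|g] /=; first by rewrite addr0 catw_rec.
apply: (le_trans _ (ler_wpM2r (exprn_ge0 g K0) (pairsum_rec p Lpos))).
rewrite !mulrDl !mulr_suml mulrA lerD //.
by apply: ler_sum => q _; rewrite mulrA.
Qed.

End CycleTypeWeights.

(** * Cutting and merging cycles by a transposition *)

Section SplitMerge.
Variable T : finType.
Implicit Types (s t : {perm T}) (x y z : T) (P : {set {set T}}).

Lemma porbit_closed_traject t x k :
  (0 < k)%N -> iter k t x = x -> porbit t x = [set z in traject t x k].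
Proof.
move=> k0 tk; apply/setP => z; rewrite inE; apply/idP/idP.
  case/porbitP => i ->; rewrite permX (divn_eq i k) addnC iterD.
  have -> : iter (i %/ k * k) t x = x.
    by elim: (i %/ k)%N => [|q IH] //; rewrite mulSn addnC iterD tk.
  by apply/trajectP; exists (i %% k)%N => //; rewrite ltn_mod.
by case/trajectP => i _ ->; rewrite -permX mem_porbit.
Qed.

Lemma uniq_traject_neq s x j k :
  uniq (traject s x k) -> (0 < j < k)%N -> iter j s x != x.
Proof.
case: k j => [|k] [|j] //.
rewrite ltnS /= => /andP[xN _] jk; apply: contraNneq xN => e.
by apply/trajectP; exists j; rewrite // -iterSr iterS.
Qed.

(** The transposition acts after [s], so the two orbits can only diverge on arrival at x or y. *)
Lemma iter_mul_tperm s x y z n :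
  (forall j, (0 < j <= n)%N -> iter j s z != x /\ iter j s z != y) ->
  iter n (s * tperm y x)%g z = iter n s z.
Proof.
elim: n => // n IH h.
rewrite iterS IH; last by move=> j /andP[j0 jn]; apply: h; rewrite j0 leqW.
have /= [hx hy] := h n.+1 (ltnSn _).
by rewrite permM tpermD // eq_sym.
Qed.

Lemma traject_mul_tperm s x y z k :
  (forall j, (0 < j < k)%N -> iter j s z != x /\ iter j s z != y) ->
  traject (s * tperm y x)%g z k = traject s z k.
Proof.
move=> h; apply: (@eq_from_nth _ z); rewrite !size_traject // => j jk.
rewrite !nth_traject //; apply: iter_mul_tperm => i /andP[i0 ij]; apply: h.
by rewrite i0 (leq_ltn_trans ij).
Qed.

Lemma iter_close_mul_tperm s x y z k : (0 < k)%N ->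
  (forall j, (0 < j < k)%N -> iter j s z != x /\ iter j s z != y) ->
  iter k (s * tperm y x)%g z = tperm y x (iter k s z).
Proof.
case: k => // k _ h; rewrite iterS iter_mul_tperm ?permM //.
Qed.

(** Put y = s^k x. The predecessor of y is redirected to x and that of x to y, so the cycle breaks
    into the arc from x up to just before y and the arc from y up to just before x; other cycles are
    untouched. *)
Lemma porbits_split s x k : (0 < k < #|porbit s x|)%N ->
  exists A B : {set T},
    [/\ porbits (s * tperm (iter k s x) x)%g =
          A |: (B |: (porbits s :\ porbit s x)),
        A \notin B |: (porbits s :\ porbit s x),
        B \notin porbits s :\ porbit s x &
        [/\ #|A| = k, #|B| = (#|porbit s x| - k)%N, x \in A & iter k s x \in B]].
Proof.
set C := porbit s x; set p := #|C|; set y := iter k s x.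
set t := (s * _)%g => /andP[k0 kp].
have pE : p = (k + (p - k))%N by rewrite subnKC // ltnW.
have := uniq_traject_porbit s x; rewrite -/C -/p {1}pE trajectD -/y.
rewrite cat_uniq => /and3P[uA nAB uB].
have xA0 : x \in traject s x k by apply/trajectP; exists 0%N.
have yB0 : y \in traject s y (p - k) by apply/trajectP; exists 0%N => //; rewrite subn_gt0.
have nAB' z : z \in traject s x k -> z \in traject s y (p - k) -> False.
  by move=> zA zB; have := hasPn nAB z zB; rewrite /= zA.
have hA j : (0 < j < k)%N -> iter j s x != x /\ iter j s x != y.
  move=> /andP[j0 jk]; split.
    by apply: (uniq_traject_neq uA); rewrite j0.
  by apply/eqP => e; apply: (nAB' y) => //; rewrite -e; apply/trajectP; exists j.
have hB j : (0 < j < p - k)%N -> iter j s y != x /\ iter j s y != y.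
  move=> /andP[j0 jk]; split.
    by apply/eqP => e; apply: (nAB' x) => //; rewrite -e; apply/trajectP; exists j.
  by apply: (uniq_traject_neq uB); rewrite j0.
have yp : iter (p - k) s y = x by rewrite /y -iterD subnK ?iter_porbit // ltnW.
have tA : porbit t x = [set z in traject s x k].
  rewrite (@porbit_closed_traject t x k) ?traject_mul_tperm //.
  by rewrite iter_close_mul_tperm // tpermL.
have tB : porbit t y = [set z in traject s y (p - k)].
  rewrite (@porbit_closed_traject t y (p - k)) ?traject_mul_tperm ?subn_gt0 //.
  by rewrite iter_close_mul_tperm ?subn_gt0 // yp tpermR.
have Cmem z : (z \in C) = (z \in porbit t x) || (z \in porbit t y).
  by rewrite tA tB !inE -mem_cat /y -trajectD subnKC ?porbit_traject // ltnW.
have yC : y \in C by rewrite Cmem porbit_id orbT.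
have tO z : z \notin C -> porbit t z = porbit s z.
  move=> zC; apply/porbit_setP => u.
  have it i : iter i t z = iter i s z.
    apply: iter_mul_tperm => j _; rewrite -permX.
    have zj : (s ^+ j)%g z \notin C by rewrite -eq_porbit_mem porbit_perm eq_porbit_mem.
    by split; apply: contraNneq zj => ->; rewrite ?porbit_id.
  by apply/porbitP/porbitP => -[i ->]; exists i; rewrite !permX it.
have nC (D : {set T}) z : z \in C -> z \in D -> D \notin porbits s :\ C.
  move=> zC zD; rewrite in_setD1; apply/negP => /andP[+ /imsetP[u _ Du]].
  move: zC zD; rewrite Du -!eq_porbit_mem => /eqP zx /eqP <-.
  by rewrite zx eqxx.
exists (porbit t x), (porbit t y); split.
- apply/setP => D; apply/idP/idP.
    case/imsetP => z _ ->; rewrite in_setU1 in_setU1.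
    have [zC|zC] := boolP (z \in C).
      by move: zC; rewrite Cmem -!eq_porbit_mem => /orP[->|->] //; rewrite orbT.
    rewrite (tO z zC); apply/orP; right; apply/orP; right.
    by rewrite in_setD1 imset_f // andbT eq_porbit_mem.
  rewrite !in_setU1 => /or3P[/eqP->|/eqP->|]; try exact: imset_f.
  rewrite in_setD1 => /andP[DC /imsetP[z _ Dz]].
  have zC : z \notin C by rewrite -eq_porbit_mem -Dz.
  by rewrite Dz -tO // imset_f.
- rewrite in_setU1 negb_or (nC _ x) ?porbit_id // andbT eq_porbit_mem tB inE.
  by apply/negP => xB; exact: (nAB' x xA0 xB).
- by apply: (nC _ y); rewrite ?porbit_id.
- split; rewrite ?porbit_id //.
    by rewrite tA cardsE (card_uniqP uA) size_traject.
  by rewrite tB cardsE (card_uniqP uB) size_traject.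
Qed.

Definition block_sizes P : seq nat := [seq #|c| | c : {set T} <- enum P].

Lemma perm_block_sizesU1 (A : {set T}) P :
  A \notin P -> perm_eq (block_sizes (A |: P)) (#|A| :: block_sizes P).
Proof.
move=> AP; rewrite /block_sizes -map_cons; apply: perm_map.
apply: uniq_perm; rewrite ?enum_uniq /= ?mem_enum ?AP ?enum_uniq // => D.
by rewrite inE !mem_enum in_setU1.
Qed.

Lemma size_block_sizes P : size (block_sizes P) = #|P|.
Proof. by rewrite size_map -cardE. Qed.

Lemma perm_block_sizesD1 (A : {set T}) P :
  A \in P -> perm_eq (block_sizes P) (#|A| :: block_sizes (P :\ A)).
Proof.
move=> AP; have h : A \notin P :\ A by rewrite setD11.
by have := perm_block_sizesU1 h; rewrite finset.setD1K.
Qed.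

Lemma perm_block_sizes_split s x k : (0 < k < #|porbit s x|)%N ->
  perm_eq (block_sizes (porbits (s * tperm (iter k s x) x)%g))
    [:: k, (#|porbit s x| - k)%N & block_sizes (porbits s :\ porbit s x)].
Proof.
move=> /porbits_split[A [B [-> nA nB [cA cB _ _]]]].
apply: perm_trans (perm_block_sizesU1 nA) _.
by rewrite cA perm_cons -cB perm_block_sizesU1.
Qed.

(** Otherwise both multiplications by the transposition, from [s] to t and from t back to [s], would
    strictly lower the number of cycles. *)
Lemma mem_porbit_mul_tperm s x y :
  y \notin porbit s x -> y \in porbit (s * tperm y x)%g x.
Proof.
move=> yx; set t := (s * _)%g; apply/negPn/negP => yxt.
have ne : x != y by apply: contraNneq yx => ->; rewrite porbit_id.
have cnt u : y \notin porbit u x ->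
    (#|porbits (u * tperm y x)%g| < #|porbits u|)%N.
  (* [porbits_mul_tperm] has the transposition as left factor; inversion swaps the sides and keeps
     the orbits. *)
  move=> yu; have /= := porbits_mul_tperm (u^-1)%g x y.
  rewrite porbitsV porbitV porbit_sym yu ne tpermC -{1}(tpermV y x) -invMg porbitsV.
  by rewrite addn1 /= addn2 => -[<-].
have := cnt _ yx; have := cnt _ yxt.
by rewrite /t -mulgA tperm2 mulg1; lia.
Qed.

(** Merging undoes a cut: the same transposition brings the product back to [s], and [porbits_split]
    applies to the product. *)
Lemma perm_block_sizes_merge s x y : y \notin porbit s x ->
  perm_eq (block_sizes (porbits (s * tperm y x)%g))
    ((#|porbit s x| + #|porbit s y|)%N ::
       block_sizes (porbits s :\ porbit s x :\ porbit s y)).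
Proof.
move=> yx; set t := (s * _)%g.
have := mem_porbit_mul_tperm yx; rewrite -/t porbit_traject => /trajectP[k kp ey].
have k0 : (0 < k)%N.
  rewrite lt0n; apply: contraNneq yx => k0.
  by rewrite ey k0 porbit_id.
have ts : (t * tperm (iter k t x) x)%g = s by rewrite -ey /t -mulgA tperm2 mulg1.
have : (0 < k < #|porbit t x|)%N by rewrite k0.
move=> /porbits_split[A [B]]; rewrite ts -ey => -[eP nA nB [cA cB xA yB]].
have inP (D : {set T}) z : z \in D -> D \in porbits s -> D = porbit s z.
  by move=> zD /imsetP[u _ Du]; apply/eqP; rewrite eq_sym Du eq_porbit_mem -Du.
have eA : A = porbit s x by apply: inP => //; rewrite eP setU11.
have eB : B = porbit s y by apply: inP => //; rewrite eP setU1r // setU11.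
rewrite -eA -eB eP (finset.setU1K nA) (finset.setU1K nB) cA cB subnKC; last exact: ltnW.
by apply: perm_block_sizesD1; apply: imset_f.
Qed.

Lemma sumn_block_sizes s : sumn (block_sizes (porbits s)) = #|T|.
Proof.
rewrite sumnE big_map big_enum -sum1_card.
rewrite (partition_big (porbit s) (mem (porbits s))) /=; last first.
  by move=> z _; apply: imset_f.
apply: eq_bigr => D /imsetP[u _ ->]; rewrite -sum1_card; apply: eq_bigl => z.
by rewrite eq_porbit_mem.
Qed.

Lemma block_sizes_gt0 s P :
  P \subset porbits s -> all (leq 1) (block_sizes P).
Proof.
move=> /fintype.subsetP sP; apply/allP => q /mapP[D]; rewrite mem_enum => /sP/imsetP[u _ ->] ->.
by rewrite lt0n card_porbit_neq0.
Qed.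

End SplitMerge.

(** * Cycle types of the neighbours in the graph *)

Definition cycle_type n (s : 'S_n) : seq nat := block_sizes (porbits s).

Lemma perm_normE n (s : 'S_n) : perm_norm s = (n - size (cycle_type s))%N.
Proof. by rewrite size_block_sizes. Qed.

Lemma size_cycle_type_le n (s : 'S_n) : (size (cycle_type s) <= n)%N.
Proof.
by rewrite size_block_sizes -[X in (_ <= X)%N]card_ord; apply: leq_imset_card.
Qed.

Lemma catw_cycle_type (R : realType) n (s : 'S_n) :
  catw R (cycle_type s) = \prod_(c in porbits s) Cat R #|c|.-1.
Proof. by rewrite /catw big_map big_enum. Qed.

(** The inclusion of 'I_m intertwines [t] with [s], so it carries the cycles of [t] to those of [s]
    other than the fixed point. *)
Lemma perm_cycle_type_fix m (s : 'S_m.+1) (t : 'S_m) :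
  s ord_max = ord_max ->
  (forall i, s (widen_ord (leqnSn m) i) = widen_ord (leqnSn m) (t i)) ->
  porbit s ord_max = [set ord_max] /\
  perm_eq (block_sizes (porbits s :\ porbit s ord_max)) (cycle_type t).
Proof.
set w := widen_ord _ => sM sw.
have w_inj : injective w by move=> i j /(congr1 val) /= /val_inj.
have wM i : w i != ord_max by rewrite -val_eqE /= ltn_eqF.
have pM : porbit s ord_max = [set ord_max].
  rewrite (@porbit_closed_traject _ s ord_max 1) //.
  by apply/setP => z; rewrite !inE.
have itw i j : (s ^+ j)%g (w i) = w ((t ^+ j)%g i).
  by elim: j => [|j IH]; rewrite ?expg0 ?perm1 // !expgSr !permM IH sw.
have pw i : porbit s (w i) = w @: porbit t i.
  apply/setP => z; apply/porbitP/imsetP => [[j ->]|[_ /porbitP[j ->] ->]].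
    by exists ((t ^+ j)%g i); rewrite ?itw ?mem_porbit.
  by exists j; rewrite itw.
split=> //.
have -> : porbits s :\ porbit s ord_max = (fun D : {set 'I_m} => w @: D) @: porbits t.
  apply/setP => D; rewrite in_setD1 pM; apply/andP/imsetP.
    move=> [+ /imsetP[z _ Dz]]; rewrite {D}Dz.
    case: (unliftP ord_max z) => [i ->|->]; last by rewrite pM eqxx.
    have -> : lift ord_max i = w i by apply: val_inj; rewrite /= /bump leqNgt ltn_ord.
    by move=> _; exists (porbit t i); [apply: imset_f | apply: pw].
  move=> [_ /imsetP[i _ ->] Di]; rewrite {D}Di -pw; split; last exact: imset_f.
  by rewrite -pM eq_porbit_mem pM inE wM.
rewrite /cycle_type /block_sizes.
have winj : injective (fun D : {set 'I_m} => w @: D) by apply: imset_inj.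
apply: (@perm_trans _ [seq #|c| | c : {set 'I_m.+1} <-
   [seq (w @: D) | D : {set 'I_m} <- enum (porbits t)]]).
  apply/perm_map/uniq_perm; rewrite ?enum_uniq // ?map_inj_uniq ?enum_uniq // => D.
  rewrite mem_enum; apply/imsetP/mapP => -[E hE ->]; exists E => //.
    by rewrite mem_enum.
  by rewrite -(mem_enum (porbits t)).
by rewrite -map_comp (eq_map (g := fun D : {set 'I_m} => #|D|)) // => D /=;
  rewrite card_imset.
Qed.

Lemma sum_porbit (R : realType) (T : finType) (s : {perm T}) x (F : T -> R) :
  \sum_(y in porbit s x | y != x) F y = 
  \sum_(k < #|porbit s x|.-1) F (iter k.+1 s x).
Proof.
have tr := porbit_traject s x; have := uniq_traject_porbit s x.
case: #|_| (card_porbit_neq0 s x) tr => // p _ tr /= /andP[xN u].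
have -> : \sum_(y in porbit s x | y != x) F y = \sum_(y <- traject s (s x) p) F y.
  rewrite (big_uniq _ u) /=; apply: eq_bigl => y; rewrite tr /= inE.
  by have [->|] := eqVneq y x; rewrite ?andbF ?andbT // (negbTE xN).
rewrite (big_nth (s x)) size_traject big_mkord; apply: eq_bigr => k _.
by rewrite nth_traject // -iterSr.
Qed.

(** Source of the factor q in the merging term: a cycle of length q can be merged through any of its
    q points. *)
Lemma sum_porbitC (R : realType) (T : finType) (s : {perm T}) x (F : {set T} -> R) :
  \sum_(y | y \notin porbit s x) F (porbit s y) = 
  \sum_(d in porbits s :\ porbit s x) #|d|%:R * F d.
Proof.
rewrite (partition_big (porbit s) (mem (porbits s :\ porbit s x))) /=; last first.
  by move=> y yx; rewrite in_setD1 imset_f // andbT eq_porbit_mem.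
apply: eq_bigr => d; rewrite in_setD1 => /andP[dx /imsetP[u _ du]].
rewrite (eq_bigr (fun=> F d)); last by move=> y /andP[_ /eqP ->].
rewrite sumr_const mulr_natl; congr (_ *+ _); apply: eq_card => y.
rewrite unfold_in /= -eq_porbit_mem du -eq_porbit_mem.
by have [->|] := eqVneq (porbit s y) (porbit s u); rewrite ?andbF ?andbT // -du.
Qed.

Section SumBound.
Variables (R : realType) (K : R) (m g : nat) (s : 'S_m.+1) (x : 'I_m.+1).
Hypothesis K_ge0 : 0 <= K.

(** Transfers [genus_bound_rec] to permutations: [F] stands for the paths that start with the dashed
    edge, [G y] for those that start with the solid edge given by y. *)
Lemma genus_bound_sum (F : R) (G : 'I_m.+1 -> R) :
  F <= (porbit s x == [set x])%:R *
    genus_bound K g (block_sizes (porbits s :\ porbit s x)) ->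
  (forall y, y != x -> y \in porbit s x ->
     G y <= genus_bound K g (cycle_type (s * tperm y x)%g)) ->
  (forall y, y \notin porbit s x ->
     G y <= if g is g'.+1 then catw R (cycle_type (s * tperm y x)%g) * K ^+ g' else 0) ->
  F + \sum_(y | y != x) G y <= genus_bound K g (cycle_type s).
Proof.
move=> hF hin hout; set L := block_sizes (porbits s :\ porbit s x) in hF *.
have Lpos : all (leq 1) L by apply: (@block_sizes_gt0 _ s); apply: subD1set.
have Cin : porbit s x \in porbits s by apply: imset_f.
have [p pE] : exists p, #|porbit s x| = p.+1.
  by exists #|porbit s x|.-1; rewrite prednK // lt0n card_porbit_neq0.
rewrite (perm_genus_bound K g (perm_block_sizesD1 Cin)) -/L pE.
apply: le_trans (genus_bound_rec g p K_ge0 Lpos).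
rewrite (bigID (fun y => y \in porbit s x)) /= addrA; apply: lerD.
  apply: lerD.
    apply: le_trans hF _; rewrite -(eqSS p 0) -pE.
    case: eqP => [->|_]; first by rewrite cards1 eqxx.
    by rewrite mul0r mulr_ge0 ?ler0n ?genus_bound_ge0.
  under eq_bigl do rewrite andbC.
  apply: le_trans (ler_sum _ (fun y h => hin y (proj2 (andP h)) (proj1 (andP h)))) _.
  rewrite sum_porbit pE; apply: ler_sum => -[k /= hk] _.
  have hk' : (0 < k.+1 < #|porbit s x|)%N by rewrite pE.
  by rewrite (perm_genus_bound K g (perm_block_sizes_split hk')) pE subSS.
rewrite (eq_bigl (fun y => y \notin porbit s x)); last first.
  by move=> y /=; case: eqVneq => // ->; rewrite porbit_id.
apply: le_trans (ler_sum _ hout) _.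
case: g => [|g']; first by rewrite big1.
rewrite /L /block_sizes big_map big_enum /= -/(block_sizes _) -/L.
rewrite -(sum_porbitC s x (fun d => Cat R (p + #|d|) * catw R L / Cat R #|d|.-1 * K ^+ g')).
apply: ler_sum => y yx.
rewrite /cycle_type (perm_catw R (perm_block_sizes_merge yx)) catw_cons pE addSn /=.
have yP : porbit s y \in porbits s :\ porbit s x.
  by rewrite in_setD1 imset_f // andbT eq_porbit_mem.
rewrite /L (perm_catw R (perm_block_sizesD1 yP)) catw_cons.
have c0 := lt0r_neq0 (Cat_gt0 R #|porbit s y|.-1).
by rewrite le_eqVlt; apply/orP; left; apply/eqP; field.
Qed.

End SumBound.

(** Writing the number of remaining solid edges as |s| + 2g, a cutting edge preserves g and, by the
    next lemma, a merging edge lowers it by 1. *)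
Lemma perm_norm_split m (s : 'S_m) x y : y != x -> y \in porbit s x ->
  perm_norm s = (perm_norm (s * tperm y x)%g).+1.
Proof.
move=> yx; rewrite porbit_traject => /trajectP[k kp ey].
have k0 : (0 < k < #|porbit s x|)%N.
  by rewrite kp andbT lt0n; apply: contraNneq yx => k0; rewrite ey k0.
have := size_cycle_type_le (s * tperm y x)%g.
rewrite !perm_normE /cycle_type ey (perm_size (perm_block_sizes_split k0)) /=.
have Cin : porbit s x \in porbits s by apply: imset_f.
rewrite (perm_size (perm_block_sizesD1 Cin)) /=. move: (size _) => q; lia.
Qed.

Lemma perm_norm_merge m (s : 'S_m) x y : y \notin porbit s x ->
  perm_norm (s * tperm y x)%g = (perm_norm s).+1.
Proof.
move=> yx; have ts : (s * tperm y x * tperm y x)%g = s by rewrite -mulgA tperm2 mulg1.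
rewrite -{2}ts; apply: perm_norm_split; last exact: mem_porbit_mul_tperm.
by apply: contraNneq yx => ->; apply: porbit_id.
Qed.

(** * Counting paths by their first edge *)

Lemma wg_paths_S0 (s : 'S_0) l p : wg_paths s l p -> p = [::] /\ l = 0%N.
Proof. by case: p => [|v p] [] //= _ _ <-. Qed.

Lemma wg_paths_S m (s : 'S_m.+1) l p : wg_paths s l p ->
  (exists i l' p', [/\ i != ord_max, l = l'.+1,
     p = to_vertex (s * tperm i ord_max)%g :: p' &
     wg_paths (s * tperm i ord_max)%g l' p']) \/
  (exists (t : 'S_m) p', [/\ s ord_max = ord_max,
     forall i, s (widen_ord (leqnSn m) i) = widen_ord (leqnSn m) (t i),
     p = to_vertex t :: p' & wg_paths t l p']).
Proof.
case: p => [|v p] []; first by move=> _ /(congr1 (@projT1 _ _)).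
move=> hp lp hl.
have /andP[uv pv] : wg_edge (to_vertex s) v && path wg_edge v p := hp.
have {}lp : last v p = wg_empty := lp.
have {}hl : (solid_edge (to_vertex s) v + nb_solid v p)%N = l := hl.
case: (boolP (solid_edge (to_vertex s) v)) uv hl => [suv|nsuv] uv <-.
  left; have /existsP[i /andP[iM /eqP vE]] := suv.
  by rewrite vE in pv lp *; exists i, (nb_solid (to_vertex (s * tperm i ord_max)%g) p), p.
right; move: uv; rewrite /wg_edge (negbTE nsuv) /=.
case/andP => /eqP sM /existsP[t /andP[/eqP vE /forallP sw]].
by rewrite vE in pv lp *; exists t, p; split=> // i; apply/eqP.
Qed.

(** A solid edge lowers |s| by at most 1, a dashed edge preserves it, and it vanishes at the end. *)
Lemma wg_paths_short m (s : 'S_m) l p : (l < perm_norm s)%N -> ~ wg_paths s l p.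
Proof.
elim: p m s l => [|v p IH] [|m] s l ls sp; try by rewrite /perm_norm in ls.
  by case: (wg_paths_S sp) => [[i [l' [p' []]]]|[t [p' []]]].
case: (wg_paths_S sp) => [[i [l' [p' [iM le [_ <-]]]]]|[t [p' [sM sw [_ <-]]]]].
  apply: IH; have [si|si] := boolP (i \in porbit s ord_max).
    by move: ls; rewrite (perm_norm_split iM si) le ltnS.
  by rewrite (perm_norm_merge si); lia.
apply: IH; have [_ e] := perm_cycle_type_fix sM sw.
move: ls; rewrite !perm_normE.
have Cin : porbit s ord_max \in porbits s by apply: imset_f.
by rewrite /cycle_type (perm_size (perm_block_sizesD1 Cin)) /= (perm_size e) subSS.
Qed.

(** A covering list, possibly with repetitions, gives finiteness and the bound at once. *)
Lemma nb_paths_le n (s : 'S_n) l (Ls : seq (seq wg_vertex)) :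
  (forall p, wg_paths s l p -> p \in Ls) -> (nb_paths s l <= size Ls)%N.
Proof.
move=> h; have fA : finite_set (wg_paths s l).
  by apply: (sub_finite_set _ (finite_seq Ls)) => p /h.
apply: uniq_leq_size; first exact: fset_uniq.
by move=> p; rewrite in_fset_set // => /set_mem /h.
Qed.

Section PathBound.
Variables (R : realType) (K : R) (n : nat).
Hypothesis K_ge : 2 * n%:R ^+ 3 <= K.

Let K_ge0 : 0 <= K.
Proof. by apply: le_trans K_ge; rewrite mulr_ge0 ?exprn_ge0. Qed.

Lemma pairsum_cycle_type_le m (s : 'S_m) :
  (m <= n)%N -> pairsum R (cycle_type s) <= K.
Proof.
move=> mn; apply: le_trans K_ge; apply: pairsum_le.
by rewrite sumn_block_sizes card_ord.
Qed.

(** Induction on m plus the number of solid edges: a dashed edge lowers the former and a solid edge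
    the latter. *)
Lemma wg_paths_cover m (s : 'S_m) g : (m <= n)%N ->
  exists Ls : seq (seq wg_vertex),
    (forall p, wg_paths s (perm_norm s + 2 * g) p -> p \in Ls) /\
    (size Ls)%:R <= genus_bound K g (cycle_type s).
Proof.
have [k] := ubnP (m + (perm_norm s + 2 * g)).
elim: k m s g => // k IH [|m] s g; rewrite ltnS => hk mn.
  have s0 : cycle_type s = [::].
    by apply: size0nil; apply/eqP; rewrite -leqn0 size_cycle_type_le.
  case: g {hk} => [|g].
    exists [:: [::]]; split; first by move=> p /wg_paths_S0[-> _]; rewrite inE.
    by rewrite s0 /= /catw big_nil.
  by exists [::]; split; [move=> p /wg_paths_S0[_]; lia | apply: genus_bound_ge0].
set l := (perm_norm s + 2 * g)%N in hk *; set x := ord_max : 'I_m.+1.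
set w := widen_ord (leqnSn m).
(* The list [Ld] covers the paths that start with the dashed edge; it is empty if there is no such
   edge. *)
have [Ld [Ldin Ldle]] : exists Ld : seq (seq wg_vertex),
   (forall (t : 'S_m) p', s x = x -> (forall i, s (w i) = w (t i)) ->
      wg_paths t l p' -> to_vertex t :: p' \in Ld) /\
   (size Ld)%:R <= (porbit s x == [set x])%:R *
     genus_bound K g (block_sizes (porbits s :\ porbit s x)).
  case: (pselect (s x = x /\ exists t : 'S_m, forall i, s (w i) = w (t i))); last first.
    move=> h; exists [::]; split; first by move=> t p' sx st; case: h; split=> //; exists t.
    by rewrite mulr_ge0 ?genus_bound_ge0.
  move=> [sx [t st]]; have [px e] : porbit s x = [set x] /\
      perm_eq (block_sizes (porbits s :\ porbit s x)) (cycle_type t).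
    exact: perm_cycle_type_fix.
  have nt : perm_norm t = perm_norm s.
    have Cin : porbit s x \in porbits s by apply: imset_f.
    by rewrite !perm_normE /cycle_type (perm_size (perm_block_sizesD1 Cin)) /= (perm_size e) subSS.
  have [||L [Lin Lle]] := IH m t g; [by rewrite nt -/l; lia | exact: ltnW |].
  exists [seq to_vertex t :: p | p <- L]; split; last first.
    by rewrite (perm_genus_bound K g e) size_map px eqxx mul1r.
  move=> t' p' _ st'; have -> : t' = t.
    apply/permP => i; have : w (t i) = w (t' i) by rewrite -st st'.
    by move/(congr1 val) => /= /val_inj.
  by move=> h; apply: map_f; apply: Lin; rewrite nt.
have /fin_all_exists[L hL] : forall y : 'I_m.+1, exists L : seq (seq wg_vertex), y != x ->
   [/\ forall l' p', l = l'.+1 -> wg_paths (s * tperm y x)%g l' p' -> p' \in L,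
       y \in porbit s x ->
         (size L)%:R <= genus_bound K g (cycle_type (s * tperm y x)%g) &
       y \notin porbit s x -> (size L)%:R <=
         if g is g'.+1 then catw R (cycle_type (s * tperm y x)%g) * K ^+ g' else 0].
  move=> y; have [->|yx] := eqVneq y x; first by exists [::].
  have [sy|sy] := boolP (y \in porbit s x).
    have nt := perm_norm_split yx sy.
    have [||L [Lin Lle]] := IH m.+1 (s * tperm y x)%g g => //.
      by move: hk; rewrite /l nt; move: (perm_norm _) => q; lia.
    exists L => _; split=> // l' p' le; have -> : l' = (perm_norm (s * tperm y x)%g + 2 * g)%N.
      by move: le; rewrite /l nt; move: (perm_norm _) => q; lia.
    exact: Lin.
  have nt := perm_norm_merge sy.
  (* For g = 0, too few solid edges remain after a merge, so the empty list suffices. *)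
  case: g @l hk {Ldin Ldle} => [|g] l hk.
    exists [::] => _; split=> // l' p' le h; exfalso; apply: wg_paths_short h.
    by rewrite nt; move: le; rewrite /l; lia.
  have [||L [Lin Lle]] := IH m.+1 (s * tperm y x)%g g => //.
      by move: hk; rewrite /l nt; move: (perm_norm _) => q; lia.
  exists L => _; split=> //.
    move=> l' p' le; have -> : l' = (perm_norm (s * tperm y x)%g + 2 * g)%N.
      by move: le; rewrite /l nt; move: (perm_norm _) => q; lia.
    exact: Lin.
  (* Here V <= K trades the factor V for one more power of K. *)
  move=> _; apply: le_trans Lle _.
  by apply: genus_bound_le => //; apply: pairsum_cycle_type_le.
pose Ly y := [seq to_vertex (s * tperm y x)%g :: p | p <- L y].
exists (Ld ++ flatten [seq Ly y | y <- enum 'I_m.+1 & y != x]); split.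
  move=> p /wg_paths_S[[i [l' [p' [ix le -> hp]]]]|[t [p' [sx st -> hp]]]]; rewrite mem_cat.
    apply/orP; right; apply/flatten_mapP; exists i; first by rewrite mem_filter ix mem_enum.
    by apply: map_f; have [h _ _] := hL i ix; apply: (h l').
  by apply/orP; left; apply: Ldin.
rewrite size_cat natrD size_flatten /shape -map_comp sumnE big_map big_filter.
rewrite big_enum_cond /= natr_sum.
apply: genus_bound_sum => // y.
  by move=> yx sy; have [_ h _] := hL y yx; rewrite size_map; apply: h.
move=> sy; have yx : y != x by apply: contraNneq sy => ->; apply: porbit_id.
by have [_ _ h] := hL y yx; rewrite size_map; apply: h.
Qed.

Lemma nb_paths_genus_le m (s : 'S_m) g : (m <= n)%N ->
  (nb_paths s (perm_norm s + 2 * g))%:R <= catw R (cycle_type s) * K ^+ g.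
Proof.
move=> mn; have [Ls [/nb_paths_le hin hle]] := wg_paths_cover s g mn.
apply: (@le_trans _ _ (size Ls)%:R); first by rewrite ler_nat.
apply: le_trans hle _.
by apply: genus_bound_le => //; apply: pairsum_cycle_type_le.
Qed.

End PathBound.

(** * Summation of the series *)

Lemma limn_series_le_geometric (R : realType) (u : R^nat) (a x : R) :
  0 <= a -> 0 <= x < 1 -> (forall g, 0 <= u g <= a * x ^+ g) ->
  limn (series u) <= a / (1 - x).
Proof.
move=> a0 /andP[x0 x1] hu.
have ub k : series u k <= a / (1 - x).
  apply: (@le_trans _ _ (\sum_(0 <= g < k) a * x ^+ g)).
    by apply: ler_sum => g _; case/andP: (hu g).
  rewrite -mulr_sumr ler_wpM2l // big_mkord -[leRHS]mul1r ler_pdivlMr ?subr_gt0 //.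
  have := subrX1 x k => e.
  have -> : (\sum_(i < k) x ^+ i) * (1 - x) = 1 - x ^+ k by rewrite mulrC -opprB mulNr -e opprB.
  by rewrite lerBlDr lerDl exprn_ge0.
(* The limit can be compared only once convergence is known; it comes from monotonicity and the
   bound [ub]. *)
apply: limr_le; last by apply: nearW.
apply: nondecreasing_is_cvgn; last by exists (a / (1 - x)) => _ [k _ <-].
by apply/nondecreasing_seqP => k; rewrite /series /= big_nat_recr //= lerDl; case/andP: (hu k).
Qed.

Theorem theorem1p1 (R : realType) (n N : nat) (hn : (1 <= n)%N) (hN : (1 <= N)%N)
    (s : 'S_n) :
  let C : R := 6 * Num.sqrt 8 * 10 ^+ 6 in
  Num.sqrt C * n%:R `^ (3 / 2) < N%:R ->
  N%:R ^+ (n + perm_norm s) * WgU R N s / Moeb R s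
    <= 1 / (1 - C * n%:R ^+ 3 / N%:R ^+ 2).
Proof.
move=> C hC; set K := C * n%:R ^+ 3; set x := K / N%:R ^+ 2.
(* This makes K dominate 2n^3, the bound on V. *)
have C2 : 2 <= C.
  have : 1 <= Num.sqrt (8 : R) by rewrite -{1}sqrtr1 ler_wsqrtr //; lra.
  by rewrite /C; lra.
have N0 : 0 < N%:R :> R by rewrite ltr0n.
have n3 : 0 <= n%:R ^+ 3 :> R by rewrite exprn_ge0.
have K2 : 2 * n%:R ^+ 3 <= K by apply: ler_wpM2r.
have K0 : 0 <= K by apply: le_trans K2; apply: mulr_ge0.
(* The square of the hypothesis on N, which makes the ratio x less than 1. *)
have KN : K < N%:R ^+ 2.
  have <- : (Num.sqrt C * n%:R `^ (3 / 2)) ^+ 2 = K.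
    rewrite exprMn sqr_sqrtr; last by apply: le_trans C2.
    rewrite -powR_mulrn ?powR_ge0 // -powRrM.
    have -> : 3 / 2 * 2%:R = 3%:R :> R by field.
    by rewrite powR_mulrn.
  by rewrite ltrXn2r ?nnegrE // ?mulr_ge0 ?sqrtr_ge0 ?powR_ge0 // ltW.
have x01 : 0 <= x < 1.
  by rewrite divr_ge0 ?exprn_ge0 //= ltr_pdivrMr ?exprn_gt0 // mul1r.
have a0 := catw_gt0 R (cycle_type s).
rewrite /WgU /Moeb -catw_cycle_type; set a := catw _ _ in a0 *; set S := limn _.
(* The signs and the powers of N cancel, leaving the series over a0. *)
have -> : N%:R ^+ (n + perm_norm s) *
    ((-1) ^+ perm_norm s * N%:R ^- (n + perm_norm s) * S) /
    ((-1) ^+ perm_norm s * a) = S / a.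
  have sz : (-1) ^+ perm_norm s != 0 :> R by rewrite signr_eq0.
  have Nz := lt0r_neq0 (exprn_gt0 (n + perm_norm s) N0).
  move: sz Nz (lt0r_neq0 a0); move: ((-1) ^+ _) (N%:R ^+ _) S a {a0} => u v S a uz vz az.
  by field; rewrite uz vz az.
rewrite ler_pdivrMr // mulrAC mul1r.
apply: limn_series_le_geometric => //; first exact: ltW.
move=> g; rewrite divr_ge0 ?exprn_ge0 ?ler0n //=.
rewrite /x expr_div_n -exprM mulrA ler_wpM2r ?invr_ge0 ?exprn_ge0 //.
exact: (nb_paths_genus_le K2).
Qed.
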